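(* Let $k$ be a commutative unital ring, let $G$ be a finite group, let $S$ be a $k^G$-comodule algebra and let $M$ be a $(k^G,S)$-Hopf module. Then there is an isomorphism of pointed sets $$\mathrm{H}^1(k^G,M)\;\cong\;\mathrm{H}^1(G,\mathrm{Aut}_S(M)),$$ where the left-hand side is the $1$-Hopf cohomology set of $k^G$ with coefficients in $M$, and the right-hand side is Serre's non-abelian group $1$-cohomology set of $G$ with coefficients in the group $\mathrm{Aut}_S(M)$ with its conjugation $G$-action.
   Context: Write $\otimes=\otimes_k$. Algebras are associative unital $k$-algebras; modules are right modules. Hopf modules. For a Hopf algebra $H$ over $k$ with multiplication $\mu_H$, unit $\eta_H$, comultiplication $\Delta_H$, counit $\varepsilon_H$ and antipode $\sigma_H$, an $H$-comodule algebra is an algebra $S$ with a right $H$-coaction $\Delta_S:S\to S\otimes H$ that is an algebra morphism. An $(H,S)$-Hopf module is an $S$-module $M$ that is also a right $H$-comodule via $\Delta_M:M\to M\otimes H$, with $\Delta_M(ms)=\Delta_M(m)\Delta_S(s)$ for all $m\in M$, $s\in S$. $\mathrm{Aut}_S(M)$ is the group of $S$-linear automorphisms of $M$. Hopf cohomology set. Let $\mathrm{W}^n_k(M)=\mathrm{Hom}_k(M,M\otimes H^{\otimes n})$. It is a monoid for the product $\odot$ given by $\varphi\odot\varphi'=\varphi\circ\varphi'$ if $n=0$ and $\varphi\odot\varphi'=(\mathrm{id}_M\otimes\mu_H^{\otimes n})\circ(\mathrm{id}_M\otimes\chi_n)\circ(\varphi\otimes\mathrm{id}_H^{\otimes n})\circ\varphi'$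 if $n>0$, where $\chi_n((a_1\otimes\cdots\otimes a_n)\otimes(b_1\otimes\cdots\otimes b_n))=(a_1\otimes b_1)\otimes\cdots\otimes(a_n\otimes b_n)$. Let $T$ be the flip of $H\otimes H$. For $k$-linear $\varphi:M\to M$ and $\Phi:M\to M\otimes H$ put $d^0\varphi=(\mathrm{id}_M\otimes\mu_H)\circ(\Delta_M\otimes\mathrm{id}_H)\circ(\varphi\otimes\sigma_H)\circ\Delta_M$, $d^1\varphi=(\mathrm{id}_M\otimes\eta_H)\circ\varphi$, $d^0\Phi=(\mathrm{id}_M\otimes\mu_H\otimes\mathrm{id}_H)\circ(\Delta_M\otimes T)\circ(\Phi\otimes\sigma_H)\circ\Delta_M$, $d^1\Phi=(\mathrm{id}_M\otimes\Delta_H)\circ\Phi$, $d^2\Phi=\Phi\otimes\eta_H$ (that is, $m\mapsto\Phi(m)\otimes 1$). $\mathrm{Z}^1(H,M)$ is the set of $\Phi\in\mathrm{W}^1_k(M)$ such that $\Phi(ms)=\Phi(m)s$ for all $m\in M,s\in S$ (where $(m\otimes h)s=ms\otimes h$), $(\mathrm{id}_M\otimes\varepsilon_H)\circ\Phi=\mathrm{id}_M$, and $d^2\Phi\odot d^0\Phi=d^1\Phi$. The group $\mathrm{Aut}_S(M)$ acts on the right on $\mathrm{Z}^1(H,M)$ by $\Phi\leftharpoonup f=d^1f^{-1}\odot\Phi\odot d^0f$; $\mathrm{H}^1(H,M)$ is the set of orbits, pointed by the class of $\mathrm{id}_M\otimes\eta_H$. The Hopf algebra $k^G$. It is $k$-free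 with basis $\{\delta_g\}_{g\in G}$; $\delta_g\delta_{g'}=\delta_g$ if $g=g'$ and $0$ otherwise, the unit is $\sum_g\delta_g$, $\Delta(\delta_g)=\sum_{ab=g}\delta_a\otimes\delta_b$, $\varepsilon(\delta_g)=1$ if $g=e$ and $0$ otherwise, $\sigma(\delta_g)=\delta_{g^{-1}}$. A $k^G$-coaction on $S$ is the same as a $G$-action on $S$, via $\Delta_S(s)=\sum_{g}g(s)\otimes\delta_g$; similarly a $(k^G,S)$-Hopf module structure on $M$ is the same as a $G$-action $\gamma:G\to\mathrm{Aut}_k(M)$ with $\gamma(g)(ms)=\gamma(g)(m)g(s)$, via $\Delta_M(m)=\sum_g\gamma(g)(m)\otimes\delta_g$. The group $G$ acts on $\mathrm{Aut}_S(M)$ by conjugation: ${}^g f=\gamma(g)\circ f\circ\gamma(g)^{-1}$. Group cohomology. For a group $G$ acting by automorphisms on a group $A$, $\mathrm{Z}^1(G,A)$ is the set of maps $\alpha:G\to A$ with $\alpha(gg')=\alpha(g)\,{}^g(\alpha(g'))$; $A$ acts on the right by $(\alpha\leftharpoonup a)(g)=a^{-1}\alpha(g)\,{}^g a$, and $\mathrm{H}^1(G,A)$ is the set of orbits, pointed by the class of the constant map $1$. *)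

(* Defs.v *)
From HB Require Import structures.
From mathcomp Require Import all_boot all_order all_algebra fingroup.
From mathcomp Require Import generic_quotient boolp classical_sets.

Set Implicit Arguments.
Unset Strict Implicit.
Unset Printing Implicit Defensive.

Import GRing.Theory.
Local Open Scope ring_scope.
Local Open Scope quotient_scope.

Lemma linear_ext (k : pzRingType) (U V : lmodType k) (f g : {linear U -> V}) :
  f =1 g -> f = g.
Proof.
move: f g => [f [[?] [?]]] [g [[?] [?]]] /= /funext efg.
by subst g; do 2!f_equal; f_equal; apply: Prop_irrelevance.
Qed.

Definition bilinear_map (k : pzRingType) (U V W : lmodType k)
    (b : U -> V -> W) : Prop :=
  (forall v, linear (b^~ v)) /\ (forall u, linear (b u)).

Section Tensor.
Variable k : comPzRingType.

Section Construction.
Variables U V : lmodType k.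

(* A list stands for the formal sum of its pairs: U (x) V is the commutative
   monoid generated by the pairs (u, v), modulo the bilinearity relations. *)
Inductive tensor_rel : seq (U * V) -> seq (U * V) -> Prop :=
| tensor_rel_refl s : tensor_rel s s
| tensor_rel_sym s t : tensor_rel s t -> tensor_rel t s
| tensor_rel_trans t s r : tensor_rel s t -> tensor_rel t r -> tensor_rel s r
| tensor_rel_cat s s' t t' :
    tensor_rel s s' -> tensor_rel t t' -> tensor_rel (s ++ t) (s' ++ t')
| tensor_rel_comm s t : tensor_rel (s ++ t) (t ++ s)
| tensor_rel_zero v : tensor_rel [:: (0, v)] [::]
| tensor_rel_addl u u' v : tensor_rel [:: (u + u', v)] [:: (u, v); (u', v)]
| tensor_rel_addr u v v' : tensor_rel [:: (u, v + v')] [:: (u, v); (u, v')]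
| tensor_rel_scale a u v : tensor_rel [:: (a *: u, v)] [:: (u, a *: v)].

Definition tensor_eqv (s t : seq (U * V)) : bool := `[< tensor_rel s t >].

Lemma tensor_eqv_equiv : equiv_class_of tensor_eqv.
Proof.
split=> [s|s t|t s r]; first by apply/asboolP/tensor_rel_refl.
- by apply/asboolP/asboolP => /tensor_rel_sym.
- move=> /asboolP st /asboolP tr; apply/asboolP.
  exact: tensor_rel_trans st tr.
Qed.

Canonical tensor_eqv_equiv_rel := EquivRelPack tensor_eqv_equiv.

Definition tensor : Type := {eq_quot tensor_eqv}.
HB.instance Definition _ := Choice.on tensor.
HB.instance Definition _ := EqQuotient.on tensor.

Definition tensor_class (s : seq (U * V)) : tensor := \pi s.
Local Notation cls := tensor_class.

Lemma tensor_classK x : cls (repr x) = x.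
Proof. exact: reprK. Qed.

Lemma tensor_classP s t : tensor_rel s t -> cls s = cls t.
Proof. by move=> st; apply/eqquotP/asboolP. Qed.

Lemma tensor_repr s : tensor_rel (repr (cls s)) s.
Proof.
have /eqquotP/asboolP : \pi_({eq_quot tensor_eqv}) (repr (cls s)) = \pi s.
  exact: tensor_classK.
by [].
Qed.

Definition scale_seq (a : k) (s : seq (U * V)) : seq (U * V) :=
  [seq (a *: p.1, p.2) | p <- s].

Lemma scale_seq_rel a s t :
  tensor_rel s t -> tensor_rel (scale_seq a s) (scale_seq a t).
Proof.
elim=> {s t}.
- by move=> s; apply: tensor_rel_refl.
- by move=> s t _; apply: tensor_rel_sym.
- by move=> t s r _ st _ tr; apply: tensor_rel_trans st tr.
- move=> s s' t t' _ ss _ tt; rewrite /scale_seq !map_cat.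
  exact: tensor_rel_cat.
- by move=> s t; rewrite /scale_seq !map_cat; apply: tensor_rel_comm.
- by move=> v; rewrite /= scaler0; apply: tensor_rel_zero.
- by move=> u u' v; rewrite /= scalerDr; apply: tensor_rel_addl.
- by move=> u v v' /=; apply: tensor_rel_addr.
- move=> b u v /=; rewrite scalerA mulrC -scalerA.
  exact: tensor_rel_scale.
Qed.

Definition tensor_add (x y : tensor) : tensor := cls (repr x ++ repr y).
Definition tensor_scale (a : k) (x : tensor) : tensor :=
  cls (scale_seq a (repr x)).

Lemma tensor_addE s t :
  tensor_add (tensor_class s) (tensor_class t) = cls (s ++ t).
Proof. by apply/tensor_classP/tensor_rel_cat; apply: tensor_repr. Qed.

Lemma tensor_scaleE a s :
  tensor_scale a (tensor_class s) = cls (scale_seq a s).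
Proof. by apply/tensor_classP/scale_seq_rel/tensor_repr. Qed.

Lemma tensor_addA : associative tensor_add.
Proof.
move=> x y z; rewrite -[x]tensor_classK -[y]tensor_classK -[z]tensor_classK.
by rewrite !tensor_addE catA.
Qed.

Lemma tensor_addC : commutative tensor_add.
Proof. by move=> x y; apply/tensor_classP/tensor_rel_comm. Qed.

Lemma tensor_add0 : left_id (cls [::]) tensor_add.
Proof. by move=> x; rewrite -[x]tensor_classK tensor_addE. Qed.

Lemma scale0_seq_rel s : tensor_rel (scale_seq 0 s) [::].
Proof.
elim: s => [|[u v] s IH] /=; first exact: tensor_rel_refl.
rewrite scale0r -[X in tensor_rel _ X]/([::] ++ [::]) -cat1s.
by apply: tensor_rel_cat => //; apply: tensor_rel_zero.
Qed.

Lemma scale_seqD_rel a b s :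
  tensor_rel (scale_seq (a + b) s) (scale_seq a s ++ scale_seq b s).
Proof.
elim: s => [|[u v] s IH] /=; first exact: tensor_rel_refl.
rewrite scalerDl -cat1s.
apply: (@tensor_rel_trans ([:: (a *: u, v); (b *: u, v)]
   ++ (scale_seq a s ++ scale_seq b s))).
  by apply: tensor_rel_cat => //; apply: tensor_rel_addl.
rewrite [X in tensor_rel X _]/= -cat1s -[X in tensor_rel _ X]cat1s.
apply: tensor_rel_cat; first exact: tensor_rel_refl.
rewrite -cat1s !catA -[X in tensor_rel _ (X ++ _ :: _)]/(scale_seq a s).
rewrite -[X in tensor_rel _ (_ ++ X)]cat1s catA.
by apply: tensor_rel_cat; [apply: tensor_rel_comm|apply: tensor_rel_refl].
Qed.

Lemma tensor_scaleDl x :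
  {morph tensor_scale^~ x : a b / a + b >-> tensor_add a b}.
Proof.
move=> a b; rewrite -[x]tensor_classK !tensor_scaleE tensor_addE.
by apply/tensor_classP/scale_seqD_rel.
Qed.

Lemma tensor_scale0 x : tensor_scale 0 x = cls [::].
Proof. by apply/tensor_classP/scale0_seq_rel. Qed.

Lemma tensor_scale1 : left_id 1 tensor_scale.
Proof.
move=> x; rewrite -[x]tensor_classK tensor_scaleE; congr cls.
by rewrite -[RHS]map_id; apply: eq_map => -[u v] /=; rewrite scale1r.
Qed.

Lemma tensor_addN :
  left_inverse (cls [::]) (tensor_scale (-1)) tensor_add.
Proof.
by move=> x; rewrite -{2}[x]tensor_scale1 -tensor_scaleDl addNr tensor_scale0.
Qed.

HB.instance Definition _ := GRing.isZmodule.Build tensor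
  tensor_addA tensor_addC tensor_add0 tensor_addN.

Lemma tensor_scaleA a b x :
  tensor_scale a (tensor_scale b x) = tensor_scale (a * b) x.
Proof.
rewrite -[x]tensor_classK !tensor_scaleE; congr cls.
by rewrite /scale_seq -map_comp; apply: eq_map => -[u v] /=; rewrite scalerA.
Qed.

Lemma tensor_scaleDr : right_distributive tensor_scale +%R.
Proof.
move=> a x y; rewrite -[x]tensor_classK -[y]tensor_classK [_ + _]tensor_addE !tensor_scaleE.
by rewrite [RHS]tensor_addE /scale_seq map_cat.
Qed.

HB.instance Definition _ := GRing.Zmodule_isLmodule.Build k tensor
  tensor_scaleA tensor_scale1 tensor_scaleDr tensor_scaleDl.

Definition tens (u : U) (v : V) : tensor := cls [:: (u, v)].

Lemma tens_bilinear : bilinear_map tens.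
Proof.
have tensZ a u v : a *: tens u v = tens (a *: u) v by exact: tensor_scaleE.
have tensD u v u' v' : tens u v + tens u' v' = cls [:: (u, v); (u', v')].
  exact: tensor_addE.
split=> [v a u u'|u a v v']; rewrite tensZ tensD.
- exact/tensor_classP/tensor_rel_addl.
- apply: tensor_classP; apply: tensor_rel_trans (tensor_rel_addr _ _ _) _.
  rewrite -cat1s -[X in tensor_rel _ X]cat1s.
  apply: tensor_rel_cat; last exact: tensor_rel_refl.
  exact/tensor_rel_sym/tensor_rel_scale.
Qed.

Lemma tensor_sum (x : tensor) : x = \sum_(p <- repr x) tens p.1 p.2.
Proof.
rewrite -[LHS]tensor_classK; elim: (repr x) => [|[u v] s IH]; first by rewrite big_nil.
by rewrite big_cons -IH [RHS]tensor_addE.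
Qed.

End Construction.
End Tensor.

Arguments tens {k U V} u v.
Notation "U '⊗' V" := (tensor U V) (at level 40, left associativity) : type_scope.
Notation "u '⊗t' v" := (tens u v) (at level 40, left associativity) : ring_scope.

Section TensorTheory.
Variable k : comPzRingType.
Implicit Types U V W : lmodType k.

Lemma tensDl U V (u u' : U) (v : V) : (u + u') ⊗t v = u ⊗t v + u' ⊗t v.
Proof. by have [/(_ v 1 u u')+ _] := tens_bilinear U V; rewrite !scale1r. Qed.

Lemma tensDr U V (u : U) (v v' : V) : u ⊗t (v + v') = u ⊗t v + u ⊗t v'.
Proof. by have [_ /(_ u 1 v v')] := tens_bilinear U V; rewrite !scale1r. Qed.

Lemma tens0l U V (v : V) : (0 : U) ⊗t v = 0.
Proof. by apply: (addrI (0 ⊗t v)); rewrite -tensDl !addr0. Qed.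

Lemma tens0r U V (u : U) : u ⊗t (0 : V) = 0.
Proof. by apply: (addrI (u ⊗t 0)); rewrite -tensDr !addr0. Qed.

Lemma tensZl U V a (u : U) (v : V) : (a *: u) ⊗t v = a *: (u ⊗t v).
Proof.
by have [/(_ v a u 0)+ _] := tens_bilinear U V; rewrite addr0 tens0l addr0.
Qed.

Lemma tensZr U V a (u : U) (v : V) : u ⊗t (a *: v) = a *: (u ⊗t v).
Proof.
by have [_ /(_ u a v 0)] := tens_bilinear U V; rewrite addr0 tens0r addr0.
Qed.

Lemma tens_suml U V I (r : seq I) (P : pred I) (F : I -> U) (v : V) :
  (\sum_(i <- r | P i) F i) ⊗t v = \sum_(i <- r | P i) (F i ⊗t v).
Proof.
by apply: (big_morph (fun u => u ⊗t v)) => [u u'|]; rewrite ?tensDl ?tens0l.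
Qed.

Lemma tens_sumr U V I (r : seq I) (P : pred I) (u : U) (F : I -> V) :
  u ⊗t (\sum_(i <- r | P i) F i) = \sum_(i <- r | P i) (u ⊗t F i).
Proof. by apply: big_morph => [v v'|]; rewrite ?tensDr ?tens0r. Qed.

Lemma tensor_linear_ext U V W (f g : {linear U ⊗ V -> W}) :
  (forall u v, f (u ⊗t v) = g (u ⊗t v)) -> f =1 g.
Proof.
move=> efg x; rewrite (tensor_sum x) !linear_sum.
by apply: eq_bigr => p _; apply: efg.
Qed.

Section Lift.
Variables (U V W : lmodType k) (b : U -> V -> W).

Definition tlift_fun (x : U ⊗ V) : W := \sum_(p <- repr x) b p.1 p.2.

Hypothesis b_bilin : bilinear_map b.

Lemma tlift_rel s t : tensor_rel s t ->
  \sum_(p <- s) b p.1 p.2 = \sum_(p <- t) b p.1 p.2.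
Proof.
have bDl u u' v : b (u + u') v = b u v + b u' v.
  by have := b_bilin.1 v 1 u u'; rewrite !scale1r.
have bDr u v v' : b u (v + v') = b u v + b u v'.
  by have := b_bilin.2 u 1 v v'; rewrite !scale1r.
have b0l v : b 0 v = 0 by apply: (addrI (b 0 v)); rewrite -bDl !addr0.
have b0r u : b u 0 = 0 by apply: (addrI (b u 0)); rewrite -bDr !addr0.
have bZl a u v : b (a *: u) v = a *: b u v.
  by have := b_bilin.1 v a u 0; rewrite addr0 b0l addr0.
have bZr a u v : b u (a *: v) = a *: b u v.
  by have := b_bilin.2 u a v 0; rewrite addr0 b0r addr0.
elim=> {s t} //.
- by move=> t s r _ -> _ ->.
- by move=> s s' t t' _ es _ et; rewrite !big_cat /= es et.
- by move=> s t; rewrite !big_cat /= addrC.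
- by move=> v; rewrite big_seq1 big_nil.
- by move=> u u' v; rewrite !big_cons !big_nil !addr0 /= bDl.
- by move=> u v v'; rewrite !big_cons !big_nil !addr0 /= bDr.
- by move=> a u v; rewrite !big_cons !big_nil !addr0 /= bZl bZr.
Qed.

Lemma tlift_pi s : tlift_fun (tensor_class s) = \sum_(p <- s) b p.1 p.2.
Proof. exact/tlift_rel/tensor_repr. Qed.

Lemma tlift_linear : linear tlift_fun.
Proof.
move=> a x y; rewrite -[x]tensor_classK -[y]tensor_classK.
have -> : a *: tensor_class (repr x) = tensor_class (scale_seq a (repr x)).
  exact: tensor_scaleE.
have -> s t : tensor_class s + tensor_class t = tensor_class (s ++ t) :> U ⊗ V.
  exact: tensor_addE.
rewrite !tlift_pi big_cat big_map /=; congr +%R.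
rewrite scaler_sumr; apply: eq_bigr => -[u v] _ /=.
have b0 : b 0 v = 0.
  apply: (addrI (b 0 v)); rewrite addr0.
  by have := b_bilin.1 v 1 0 0; rewrite !scale1r addr0 => {3}->.
by have := b_bilin.1 v a u 0; rewrite addr0 b0 addr0.
Qed.

End Lift.
End TensorTheory.

HB.lock Definition tlift (k : comPzRingType) (U V W : lmodType k)
    (b : U -> V -> W) (b_bilin : bilinear_map b) : {linear U ⊗ V -> W} :=
  HB.pack (tlift_fun b)
    (GRing.isLinear.Build k (U ⊗ V) W *:%R _ (tlift_linear b_bilin)).

Lemma tliftE (k : comPzRingType) (U V W : lmodType k) (b : U -> V -> W)
    (b_bilin : bilinear_map b) u v :
  tlift b_bilin (u ⊗t v) = b u v.
Proof. by rewrite tlift.unlock /= tlift_pi // big_seq1. Qed.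

Section StandardMaps.
Variable k : comPzRingType.
Implicit Types U V W : lmodType k.

Lemma tens_comp_bilin U V U' V' (f : {linear U -> U'}) (g : {linear V -> V'}) :
  bilinear_map (fun u v => f u ⊗t g v).
Proof.
split=> [v a u u'|u a v v'] /=; rewrite linearP.
- by rewrite tensDl tensZl.
- by rewrite tensDr tensZr.
Qed.

Definition tmap U V U' V' (f : {linear U -> U'}) (g : {linear V -> V'}) :
  {linear U ⊗ V -> U' ⊗ V'} := tlift (tens_comp_bilin f g).

Lemma tmapE U V U' V' (f : {linear U -> U'}) (g : {linear V -> V'}) u v :
  tmap f g (u ⊗t v) = f u ⊗t g v.
Proof. exact: tliftE. Qed.

Definition tid U : {linear U -> U} := idfun.

Lemma tflip_bilin U V : bilinear_map (fun (u : U) (v : V) => v ⊗t u).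
Proof.
by split=> [v a u u'|u a v v']; rewrite ?(tensDl, tensDr) ?(tensZl, tensZr).
Qed.

Definition tflip U V : {linear U ⊗ V -> V ⊗ U} := tlift (@tflip_bilin U V).

Lemma tflipE U V (u : U) (v : V) : tflip U V (u ⊗t v) = v ⊗t u.
Proof. exact: tliftE. Qed.

Lemma tens_r_linear U V (v : V) : linear (fun u : U => u ⊗t v).
Proof. by move=> a u u'; rewrite tensDl tensZl. Qed.

Lemma tens_l_linear U V (u : U) : linear (fun v : V => u ⊗t v).
Proof. by move=> a v v'; rewrite tensDr tensZr. Qed.

Definition tens_r U V (v : V) : {linear U -> U ⊗ V} :=
  HB.pack (fun u : U => u ⊗t v)
    (GRing.isLinear.Build k U (U ⊗ V) *:%R _ (tens_r_linear v)).

Definition tens_l U V (u : U) : {linear V -> U ⊗ V} :=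
  HB.pack (fun v : V => u ⊗t v)
    (GRing.isLinear.Build k V (U ⊗ V) *:%R _ (tens_l_linear u)).

Lemma tassoc_bilin U V W : bilinear_map (fun (x : U ⊗ V) (w : W) =>
  tmap (tid U) (tens_r V w) x).
Proof.
split=> [w a x x'|x a w w']; first exact: linearP.
move: (repr x) (tensor_sum x) => s ->; rewrite !linear_sum -big_split /=.
by apply: eq_bigr => p _; rewrite !tmapE /= !tensDr !tensZr.
Qed.

Definition tassoc U V W : {linear U ⊗ V ⊗ W -> U ⊗ (V ⊗ W)} :=
  tlift (@tassoc_bilin U V W).

Lemma tassocE U V W (u : U) (v : V) (w : W) :
  tassoc U V W (u ⊗t v ⊗t w) = u ⊗t (v ⊗t w).
Proof. by rewrite [LHS]tliftE tmapE. Qed.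

Lemma tassocV_bilin U V W : bilinear_map (fun (u : U) (x : V ⊗ W) =>
  tmap (tens_l V u) (tid W) x).
Proof.
split=> [x a u u'|u a x x']; last exact: linearP.
move: (repr x) (tensor_sum x) => s ->; rewrite !linear_sum -big_split /=.
by apply: eq_bigr => p _; rewrite !tmapE /= !(tensDl, tensZl).
Qed.

Definition tassocV U V W : {linear U ⊗ (V ⊗ W) -> U ⊗ V ⊗ W} :=
  tlift (@tassocV_bilin U V W).

Lemma tassocVE U V W (u : U) (v : V) (w : W) :
  tassocV U V W (u ⊗t (v ⊗t w)) = u ⊗t v ⊗t w.
Proof. by rewrite [LHS]tliftE tmapE. Qed.

Lemma trunit_bilin U : bilinear_map (fun (u : U) (a : k^o) => (a : k) *: u).
Proof.
split=> [v a u u'|u a v v']; rewrite ?scalerDr ?scalerDl !scalerA //.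
by rewrite mulrC.
Qed.

Definition trunit U : {linear U ⊗ k^o -> U} := tlift (@trunit_bilin U).

Lemma trunitE U (u : U) (a : k) : trunit U (u ⊗t (a : k^o)) = a *: u.
Proof. exact: tliftE. Qed.

Lemma tlunit_bilin U : bilinear_map (fun (a : k^o) (u : U) => (a : k) *: u).
Proof.
split=> [v a u u'|u a v v']; rewrite ?scalerDr ?scalerDl !scalerA //.
by rewrite mulrC.
Qed.

Definition tlunit U : {linear k^o ⊗ U -> U} := tlift (@tlunit_bilin U).

Lemma tlunitE U (a : k) (u : U) : tlunit U ((a : k^o) ⊗t u) = a *: u.
Proof. exact: tliftE. Qed.

End StandardMaps.

(* Not algType, which requires 1 != 0: neither the zero algebra nor some tensor
   products of nonzero algebras satisfy this.  There is no room in the ssralg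
   hierarchy for a join of pzRingType and lmodType below lSemiAlgType, hence
   the dedicated product. *)
HB.mixin Record isAssocAlgebra (k : pzRingType) A of GRing.Lmodule k A := {
  aone : A;
  amul : A -> A -> A;
  amulA : associative amul;
  amul1l : left_id aone amul;
  amul1r : right_id aone amul;
  amul_bilin : bilinear_map amul
}.

#[short(type="assocAlgType")]
HB.structure Definition AssocAlgebra (k : pzRingType) :=
  { A of GRing.Lmodule k A & isAssocAlgebra k A }.

Arguments aone {k s}.
Notation "x '∙' y" := (amul x y) (at level 40, left associativity) : ring_scope.
Notation "'𝟙'" := aone (at level 0) : ring_scope.

Section Multiplication.
Variables (k : comPzRingType) (A : assocAlgType k).

Definition amu : {linear A ⊗ A -> A} := tlift (@amul_bilin k A).

Lemma amuE (x y : A) : amu (x ⊗t y) = x ∙ y.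
Proof. exact: tliftE. Qed.

End Multiplication.

Section TensorAlgebra.
Variables (k : comPzRingType) (A B : assocAlgType k).

Definition tmid (U V U' V' : lmodType k) :
    {linear (U ⊗ V) ⊗ (U' ⊗ V') -> (U ⊗ U') ⊗ (V ⊗ V')} :=
  tassocV U U' (V ⊗ V')
  \o tmap (tid U) (tassoc U' V V')
  \o tmap (tid U) (tmap (tflip V U') (tid V'))
  \o tmap (tid U) (tassocV V U' V')
  \o tassoc U V (U' ⊗ V').

Lemma tmidE (U V U' V' : lmodType k) (u : U) (v : V) (u' : U') (v' : V') :
  tmid U V U' V' ((u ⊗t v) ⊗t (u' ⊗t v')) = (u ⊗t u') ⊗t (v ⊗t v').
Proof. by rewrite /tmid /= !(tassocE, tassocVE, tmapE, tflipE) /=. Qed.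

Definition tens_one : A ⊗ B := 𝟙 ⊗t 𝟙.
Definition tens_mul (x y : A ⊗ B) : A ⊗ B :=
  tmap (amu A) (amu B) (tmid A B A B (x ⊗t y)).

Lemma tens_mulE a b a' b' :
  tens_mul (a ⊗t b) (a' ⊗t b') = (a ∙ a') ⊗t (b ∙ b').
Proof. by rewrite /tens_mul tmidE tmapE !amuE. Qed.

Lemma tens_mul_bilin : bilinear_map tens_mul.
Proof.
split=> [y a x x'|x a y y']; rewrite /tens_mul.
- by rewrite tensDl tensZl !linearP.
- by rewrite tensDr tensZr !linearP.
Qed.

Lemma tens_mul_suml I (r : seq I) (F : I -> A ⊗ B) y :
  tens_mul (\sum_(i <- r) F i) y = \sum_(i <- r) tens_mul (F i) y.
Proof. by rewrite /tens_mul tens_suml !linear_sum. Qed.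

Lemma tens_mul_sumr I (r : seq I) (F : I -> A ⊗ B) x :
  tens_mul x (\sum_(i <- r) F i) = \sum_(i <- r) tens_mul x (F i).
Proof. by rewrite /tens_mul tens_sumr !linear_sum. Qed.

Lemma tens_mulZ (a b : k) x y :
  tens_mul (a *: x) (b *: y) = (a * b) *: tens_mul x y.
Proof. by rewrite /tens_mul tensZl tensZr !linearZ /= scalerA. Qed.

Lemma tens_mulA : associative tens_mul.
Proof.
move=> x y z; move: (repr x) (tensor_sum x) => sx ->.
move: (repr y) (tensor_sum y) (repr z) (tensor_sum z) => sy -> sz ->.
rewrite !tens_mul_suml; apply: eq_bigr => p _.
rewrite ![tens_mul _ (\sum_(i <- sy) _)]tens_mul_sumr tens_mul_suml.
apply: eq_bigr => q _.
rewrite ?tens_mul_suml !tens_mul_sumr; apply: eq_bigr => r _.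
by rewrite !tens_mulE !amulA.
Qed.

Lemma tens_mul1l : left_id tens_one tens_mul.
Proof.
move=> x; rewrite [x in LHS]tensor_sum tens_mul_sumr [RHS]tensor_sum.
by apply: eq_bigr => p _; rewrite tens_mulE !amul1l.
Qed.

Lemma tens_mul1r : right_id tens_one tens_mul.
Proof.
move=> x; rewrite [x in LHS]tensor_sum tens_mul_suml [RHS]tensor_sum.
by apply: eq_bigr => p _; rewrite tens_mulE !amul1r.
Qed.

HB.instance Definition _ := isAssocAlgebra.Build k (A ⊗ B)
  tens_mulA tens_mul1l tens_mul1r tens_mul_bilin.

Lemma tensM (a a' : A) (b b' : B) :
  (a ⊗t b) ∙ (a' ⊗t b') = (a ∙ a') ⊗t (b ∙ b').
Proof. exact: tens_mulE. Qed.

End TensorAlgebra.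

HB.mixin Record isHopfAlgebra (k : comPzRingType) H of AssocAlgebra k H := {
  comul : {linear H -> H ⊗ H};
  counit : {linear H -> k^o};
  antipode : {linear H -> H};
  comulA : forall x : H,
    tassoc H H H (tmap comul (tid H) (comul x)) = tmap (tid H) comul (comul x);
  comul_counitl : forall x : H, tlunit H (tmap counit (tid H) (comul x)) = x;
  comul_counitr : forall x : H, trunit H (tmap (tid H) counit (comul x)) = x;
  comul1 : comul 𝟙 = 𝟙;
  comulM : forall x y : H, comul (x ∙ y) = comul x ∙ comul y;
  counit1 : counit 𝟙 = (1 : k);
  counitM : forall x y : H, counit (x ∙ y) = (counit x : k) * counit y;
  antipodel : forall x : H,
    amu H (tmap antipode (tid H) (comul x)) = (counit x : k) *: 𝟙;
  antipoder : forall x : H,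
    amu H (tmap (tid H) antipode (comul x)) = (counit x : k) *: 𝟙
}.

#[short(type="hopfAlgType")]
HB.structure Definition HopfAlgebra (k : comPzRingType) :=
  { H of AssocAlgebra k H & isHopfAlgebra k H }.

HB.mixin Record isComodule (k : comPzRingType) (H : hopfAlgType k) M
    of GRing.Lmodule k M := {
  coaction : {linear M -> M ⊗ H};
  coactionA : forall m : M,
    tassoc M H H (tmap coaction (tid H) (coaction m))
    = tmap (tid M) comul (coaction m);
  coaction_counit : forall m : M,
    trunit M (tmap (tid M) counit (coaction m)) = m
}.

#[short(type="comoduleType")]
HB.structure Definition Comodule (k : comPzRingType) (H : hopfAlgType k) :=
  { M of GRing.Lmodule k M & isComodule k H M }.

HB.mixin Record isComoduleAlgebra (k : comPzRingType) (H : hopfAlgType k) S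
    of AssocAlgebra k S & Comodule k H S := {
  coaction1 : coaction (𝟙 : S) = (𝟙 : S ⊗ H);
  coactionM : forall s t : S,
    coaction (s ∙ t) = (coaction s : S ⊗ H) ∙ coaction t
}.

#[short(type="comodAlgType")]
HB.structure Definition ComoduleAlgebra (k : comPzRingType)
    (H : hopfAlgType k) :=
  { S of AssocAlgebra k S & Comodule k H S & isComoduleAlgebra k H S }.

HB.mixin Record isRightModule (k : comPzRingType) (S : assocAlgType k) M
    of GRing.Lmodule k M := {
  ract : M -> S -> M;
  ract_bilin : bilinear_map ract;
  ract1 : forall m : M, ract m 𝟙 = m;
  ractA : forall (m : M) (s t : S), ract m (s ∙ t) = ract (ract m s) t
}.

#[short(type="rightModType")]
HB.structure Definition RightModule (k : comPzRingType) (S : assocAlgType k) :=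
  { M of GRing.Lmodule k M & isRightModule k S M }.

Notation "m '⊲' s" := (ract m s) (at level 40, left associativity) : ring_scope.

Section TensorModule.
Variables (k : comPzRingType) (S A : assocAlgType k) (M : rightModType S).

Definition ract_map : {linear M ⊗ S -> M} := tlift (@ract_bilin k S M).

Lemma ract_mapE m s : ract_map (m ⊗t s) = m ⊲ s.
Proof. exact: tliftE. Qed.

Definition tens_ract (x : M ⊗ A) (y : S ⊗ A) : M ⊗ A :=
  tmap ract_map (amu A) (tmid M A S A (x ⊗t y)).

Lemma tens_ractE m a s b :
  tens_ract (m ⊗t a) (s ⊗t b) = (m ⊲ s) ⊗t (a ∙ b).
Proof. by rewrite /tens_ract tmidE tmapE ract_mapE amuE. Qed.

Lemma tens_ract_suml I (r : seq I) (F : I -> M ⊗ A) y :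
  tens_ract (\sum_(i <- r) F i) y = \sum_(i <- r) tens_ract (F i) y.
Proof. by rewrite /tens_ract tens_suml !linear_sum. Qed.

Lemma tens_ract_sumr I (r : seq I) (F : I -> S ⊗ A) x :
  tens_ract x (\sum_(i <- r) F i) = \sum_(i <- r) tens_ract x (F i).
Proof. by rewrite /tens_ract tens_sumr !linear_sum. Qed.

Lemma ractr_linear (s : S) : linear (fun m : M => m ⊲ s).
Proof. by case: (@ract_bilin k S M) => /(_ s). Qed.

Definition ractr (s : S) : {linear M -> M} :=
  HB.pack (fun m : M => m ⊲ s)
    (GRing.isLinear.Build k M M *:%R _ (ractr_linear s)).

End TensorModule.

HB.mixin Record isHopfModule (k : comPzRingType) (H : hopfAlgType k)
    (S : comodAlgType H) M of RightModule k S M & Comodule k H M := {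
  coaction_ract : forall (m : M) (s : S),
    coaction (m ⊲ s) = tens_ract (coaction m : M ⊗ H) (coaction s : S ⊗ H)
}.

#[short(type="hopfModType")]
HB.structure Definition HopfModule (k : comPzRingType) (H : hopfAlgType k)
    (S : comodAlgType H) :=
  { M of RightModule k S M & Comodule k H M & isHopfModule k H S M }.

Section Aut.
Variables (k : comPzRingType) (S : assocAlgType k) (M : rightModType S).

(* k-linearity is implied by additivity and S-linearity; bundling it gives
   access to the k-linear maps used in the coboundaries. *)
Definition is_autS (f : {linear M -> M}) : Prop :=
  (forall (m : M) (s : S), f (m ⊲ s) = f m ⊲ s) /\ bijective f.

Definition autS : Type := {f : {linear M -> M} | is_autS f}.

Definition autS_fun (f : autS) : {linear M -> M} := sval f.

HB.instance Definition _ := gen_eqMixin autS.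
HB.instance Definition _ := gen_choiceMixin autS.

Lemma autS_ext (f g : autS) : autS_fun f =1 autS_fun g -> f = g.
Proof.
move: f g => [f pf] [g pg] /linear_ext/= efg; subst g.
by f_equal; apply: Prop_irrelevance.
Qed.

Lemma autS_one_subproof : is_autS (tid M).
Proof. by split=> //; exists idfun. Qed.

Definition autS_one : autS := exist _ (tid M) autS_one_subproof.

Lemma autS_mul_subproof (f g : autS) : is_autS (autS_fun f \o autS_fun g).
Proof.
case: f g => [f [fS fb]] [g [gS gb]]; split=> [m s|] /=; first by rewrite gS fS.
exact: bij_comp.
Qed.

Definition autS_mul (f g : autS) : autS := exist _ _ (autS_mul_subproof f g).

Lemma autS_inv_exists (f : autS) : exists g : autS,
  cancel (autS_fun f) (autS_fun g) /\ cancel (autS_fun g) (autS_fun f).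
Proof.
case: f => [f [fS [g fK gK]]] /=.
have g_lin : linear g.
  by move=> a x y; apply: (can_inj fK); rewrite linearP !gK.
pose G : {linear M -> M} :=
  HB.pack g (GRing.isLinear.Build k M M *:%R _ g_lin).
have G_aut : is_autS G.
  split=> [m s|] /=; last by exists f.
  by apply: (can_inj fK); rewrite fS !gK.
by exists (exist _ G G_aut); split.
Qed.

Definition autS_inv (f : autS) : autS := sval (cid (autS_inv_exists f)).

Lemma autS_mulA : associative autS_mul.
Proof. by move=> f g h; apply: autS_ext. Qed.

Lemma autS_mul1l : left_id autS_one autS_mul.
Proof. by move=> f; apply: autS_ext. Qed.

Lemma autS_mul1r : right_id autS_one autS_mul.
Proof. by move=> f; apply: autS_ext. Qed.

Lemma autS_mulVl : left_inverse autS_one autS_inv autS_mul.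
Proof.
by move=> f; apply: autS_ext => m; case: (svalP (cid (autS_inv_exists f))) => + _;
  apply.
Qed.

Lemma autS_mulVr : right_inverse autS_one autS_inv autS_mul.
Proof.
by move=> f; apply: autS_ext => m; case: (svalP (cid (autS_inv_exists f))) => _;
  apply.
Qed.

HB.instance Definition _ := isGroup.Build autS
  autS_mulA autS_mul1l autS_mul1r autS_mulVl autS_mulVr.

End Aut.

Arguments autS {k S} M.

Definition orbit_of (Z : Type) (R : Z -> Z -> Prop) (z : Z) : set Z :=
  [set z' | R z z']%classic.

Definition orbits (Z : Type) (R : Z -> Z -> Prop) : Type :=
  {O : set Z | exists z, O = orbit_of R z}.

Definition orbit_class (Z : Type) (R : Z -> Z -> Prop) (z : Z) : orbits R :=
  exist _ (orbit_of R z) (ex_intro _ z erefl).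

Section HopfCohomology.
Variables (k : comPzRingType) (H : hopfAlgType k) (S : comodAlgType H).
Variable M : hopfModType S.

(* The product of W^n for A = H^{(x) n}, n > 0: the multiplication of the
   algebra A is mu_H^{(x) n} \o chi_n. *)
Definition odot (A : assocAlgType k) (phi psi : {linear M -> M ⊗ A}) :
    {linear M -> M ⊗ A} :=
  tmap (tid M) (amu A) \o tassoc M A A \o tmap phi (tid A) \o psi.

(* cobord<i>_<n> is d^i on W^n; iterated tensor products are bracketed as
   M (x) (H (x) H), and M (x) k is identified with M in id_M (x) eta_H. *)
Definition cobord0_0 (phi : {linear M -> M}) : {linear M -> M ⊗ H} :=
  tmap (tid M) (amu H) \o tassoc M H H \o tmap coaction (tid H)
  \o tmap phi antipode \o coaction.

Definition cobord1_0 (phi : {linear M -> M}) : {linear M -> M ⊗ H} :=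
  tens_r M (𝟙 : H) \o phi.

Definition cobord0_1 (Phi : {linear M -> M ⊗ H}) : {linear M -> M ⊗ (H ⊗ H)} :=
  tmap (tid M) (tmap (amu H) (tid H))
  \o tmap (tid M) (tassocV H H H) \o tassoc M H (H ⊗ H)
  \o tmap coaction (tflip H H)
  \o tassoc M H H \o tmap Phi antipode \o coaction.

Definition cobord1_1 (Phi : {linear M -> M ⊗ H}) : {linear M -> M ⊗ (H ⊗ H)} :=
  tmap (tid M) comul \o Phi.

Definition cobord2_1 (Phi : {linear M -> M ⊗ H}) : {linear M -> M ⊗ (H ⊗ H)} :=
  tassoc M H H \o tens_r (M ⊗ H) (𝟙 : H) \o Phi.

Definition is_hopf_cocycle (Phi : {linear M -> M ⊗ H}) : Prop :=
  [/\ forall (m : M) (s : S), Phi (m ⊲ s) = tmap (ractr M s) (tid H) (Phi m),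
      forall m : M, trunit M (tmap (tid M) counit (Phi m)) = m
    & odot (cobord2_1 Phi) (cobord0_1 Phi) = cobord1_1 Phi].

Definition hopfZ1 : Type := {Phi : {linear M -> M ⊗ H} | is_hopf_cocycle Phi}.

(* The right action of Aut_S(M), Phi <- f = d^1 f^-1 (.) Phi (.) d^0 f. *)
Definition hopf_twist (Phi : {linear M -> M ⊗ H}) (f : autS M) :
    {linear M -> M ⊗ H} :=
  odot (odot (cobord1_0 (autS_fun f^-1%g)) Phi) (cobord0_0 (autS_fun f)).

Definition hopf_cohomologous (Phi Phi' : hopfZ1) : Prop :=
  exists f : autS M, sval Phi' = hopf_twist (sval Phi) f.

Definition hopfH1 : Type := orbits hopf_cohomologous.

Lemma coaction_antipode (m : M) :
  tmap (tid M) (amu H) (tassoc M H H (tmap coaction antipode (coaction m)))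
  = m ⊗t (𝟙 : H).
Proof.
have E : tmap (tid M) (amu H) \o tassoc M H H \o tmap coaction antipode
    =1 tmap (tid M) (amu H \o tmap (tid H) antipode) \o tassoc M H H
       \o tmap coaction (tid H).
  apply: tensor_linear_ext => n h /=; rewrite !tmapE /=.
  move: (coaction n : M ⊗ H) => x.
  rewrite (tensor_sum x) !tens_suml !linear_sum; apply: eq_bigr => p _.
  by rewrite !tassocE tmapE tmapE /= tmapE.
have /= -> := E (coaction m); rewrite coactionA.
have F : tmap (tid M) (amu H \o tmap (tid H) antipode) \o tmap (tid M) comul
    =1 tens_r M (𝟙 : H) \o trunit M \o tmap (tid M) counit.
  apply: tensor_linear_ext => n h /=; rewrite !tmapE /= antipoder.
  by rewrite trunitE tensZl tensZr.
by have /= -> := F (coaction m); rewrite coaction_counit.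
Qed.

Lemma hopf_cocycle1 : is_hopf_cocycle (tens_r M (𝟙 : H)).
Proof.
split=> [m s|m|]; first by rewrite /= tmapE.
  by rewrite /= tmapE trunitE counit1 scale1r.
have E : tmap (tid M) (tmap (amu H) (tid H)) \o tmap (tid M) (tassocV H H H)
      \o tassoc M H (H ⊗ H) \o tmap coaction (tflip H H)
      \o tassoc M H H \o tmap (tens_r M (𝟙 : H)) antipode
    =1 tmap (tid M) (tens_r H (𝟙 : H)) \o
       (tmap (tid M) (amu H) \o tassoc M H H \o tmap coaction antipode).
  apply: tensor_linear_ext => n h /=; rewrite !(tmapE, tassocE) /= tflipE.
  move: (coaction n : M ⊗ H) => x.
  rewrite (tensor_sum x) !tens_suml !linear_sum; apply: eq_bigr => p _.
  by rewrite /= !(tassocE, tassocVE, tmapE) /= amuE.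
apply: linear_ext => m; rewrite /odot /cobord0_1 /=.
have /= -> := E (coaction m); rewrite coaction_antipode.
rewrite !(tmapE, tassocE) /= !tassocE !tmapE /= amuE comul1.
by rewrite amul1l.
Qed.

Definition hopfZ1_one : hopfZ1 := exist _ _ hopf_cocycle1.

HB.instance Definition _ := gen_eqMixin hopfH1.
HB.instance Definition _ := gen_choiceMixin hopfH1.
HB.instance Definition _ := isPointed.Build hopfH1
  (orbit_class hopf_cohomologous hopfZ1_one).

End HopfCohomology.

Arguments hopfH1 {k} H {S} M.

Section GroupCohomology.
Local Open Scope group_scope.

Record group_action (G A : groupType) := GroupActionOnGroup {
  gact_fun :> G -> A -> A;
  gact_fun1 : forall a, gact_fun 1 a = a;
  gact_funM : forall g h a, gact_fun (g * h) a = gact_fun g (gact_fun h a);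
  gact_fun_morph : forall g a b,
    gact_fun g (a * b) = gact_fun g a * gact_fun g b
}.

Variables (G A : groupType) (act : group_action G A).

Definition groupZ1 : Type :=
  {alpha : G -> A |
    forall g g', alpha (g * g') = alpha g * act g (alpha g')}.

Definition group_cohomologous (alpha beta : groupZ1) : Prop :=
  exists a : A, forall g, sval beta g = a^-1 * sval alpha g * act g a.

Definition groupH1 : Type := orbits group_cohomologous.

Lemma act1 g : act g 1 = 1.
Proof. by apply: (mulIg (act g 1)); rewrite -gact_fun_morph !mul1g. Qed.

Lemma groupZ1_one_subproof (g g' : G) : 1 = 1 * act g 1 :> A.
Proof. by rewrite act1 mul1g. Qed.

Definition groupZ1_one : groupZ1 := exist _ (fun=> 1) groupZ1_one_subproof.

HB.instance Definition _ := gen_eqMixin groupH1.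
HB.instance Definition _ := gen_choiceMixin groupH1.
HB.instance Definition _ := isPointed.Build groupH1
  (orbit_class group_cohomologous groupZ1_one).

End GroupCohomology.

(* The Hopf algebra k^G: f stands for \sum_g f(g) delta_g, and the structure
   maps are the linear extensions of their values on the delta_g. *)
Definition dual_group_alg (k : comPzRingType) (G : finGroupType) : Type :=
  {ffun G -> k^o}.

Section DualGroupAlgebra.
Variables (k : comPzRingType) (G : finGroupType).
Local Notation H := (dual_group_alg k G).

HB.instance Definition _ := GRing.Lmodule.on H.

Implicit Types (f : H) (g : G).

Definition dual_delta g : H := [ffun x => (x == g)%:R].
Local Notation δ := dual_delta.

Definition dual_one : H := \sum_g δ g.
Definition dual_mul f f' : H := [ffun g => (f g : k) * f' g].

Lemma dual_oneE g : (dual_one g : k) = 1.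
Proof.
rewrite sum_ffunE (bigD1 g) //= ffunE eqxx big1 ?addr0 // => h hg.
by rewrite ffunE eq_sym (negPf hg).
Qed.

Lemma dual_mulA : associative dual_mul.
Proof. by move=> f f' f''; apply/ffunP => g; rewrite !ffunE mulrA. Qed.

Lemma dual_mul1l : left_id dual_one dual_mul.
Proof. by move=> f; apply/ffunP => g; rewrite !ffunE dual_oneE mul1r. Qed.

Lemma dual_mul1r : right_id dual_one dual_mul.
Proof. by move=> f; apply/ffunP => g; rewrite !ffunE dual_oneE mulr1. Qed.

Lemma dual_mul_bilin : bilinear_map dual_mul.
Proof.
split=> [f a x y|f a x y]; apply/ffunP => g; rewrite !ffunE.
- by rewrite mulrDl -mulrA.
- by rewrite mulrDr mulrCA.
Qed.

HB.instance Definition _ := isAssocAlgebra.Build k H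
  dual_mulA dual_mul1l dual_mul1r dual_mul_bilin.

Lemma dual_deltaM g g' : δ g ∙ δ g' = if g == g' then δ g else 0.
Proof.
apply/ffunP => x; rewrite ffunE !ffunE.
case: (altP (x =P g)) => [->|xg].
  by rewrite mul1r; case: ifP => gg; rewrite !ffunE ?eqxx.
by rewrite mul0r; case: ifP => gg; rewrite !ffunE // (negPf xg).
Qed.

Lemma dual_decomp f : f = \sum_g (f g : k) *: δ g.
Proof.
apply/ffunP => x; rewrite sum_ffunE (bigD1 x) //= big1 => [|g gx].
  by rewrite addr0 !ffunE eqxx [RHS]mulr1.
by rewrite !ffunE eq_sym (negPf gx) [LHS]mulr0.
Qed.

Lemma dual_linear_ext (W : lmodType k) (u v : {linear H -> W}) :
  (forall g, u (δ g) = v (δ g)) -> u =1 v.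
Proof.
move=> uv f; rewrite (dual_decomp f) !linear_sum; apply: eq_bigr => g _.
by rewrite !linearZ uv.
Qed.

Section Extension.
Variables (W : lmodType k) (w : G -> W).

Lemma dual_ext_linear : linear (fun f : H => \sum_g (f g : k) *: w g).
Proof.
move=> a x y; rewrite scaler_sumr -big_split; apply: eq_bigr => g _ /=.
by rewrite !ffunE scalerDl scalerA.
Qed.

End Extension.
End DualGroupAlgebra.

HB.lock Definition dual_ext (k : comPzRingType) (G : finGroupType)
    (W : lmodType k) (w : G -> W) : {linear dual_group_alg k G -> W} :=
  HB.pack (fun f : dual_group_alg k G => \sum_g (f g : k) *: w g)
    (GRing.isLinear.Build k (dual_group_alg k G) W *:%R _ (dual_ext_linear w)).

Section DualHopf.
Variables (k : comPzRingType) (G : finGroupType).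
Local Notation H := (dual_group_alg k G).
Local Notation δ := (@dual_delta k G).
Implicit Types (f : H) (g : G).

Lemma dual_extS (W : lmodType k) (w : G -> W) f :
  dual_ext w f = \sum_g (f g : k) *: w g.
Proof. by rewrite dual_ext.unlock. Qed.

Lemma dual_extE (W : lmodType k) (w : G -> W) g : dual_ext w (δ g) = w g.
Proof.
rewrite dual_extS (bigD1 g) //= big1 => [|h hg]; rewrite !ffunE ?eqxx.
  by rewrite scale1r addr0.
by rewrite (negPf hg) scale0r.
Qed.

Definition dual_comul : {linear H -> H ⊗ H} :=
  dual_ext (fun g => \sum_(p : G * G | (p.1 * p.2)%g == g) δ p.1 ⊗t δ p.2).
Definition dual_counit : {linear H -> k^o} :=
  dual_ext (fun g => (g == 1%g)%:R : k^o).
Definition dual_antipode : {linear H -> H} := dual_ext (fun g => δ g^-1%g).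

Lemma dual_counitE f : dual_counit f = f 1%g.
Proof.
rewrite dual_extS (bigD1 1%g) //= big1 => [|g /negPf->]; rewrite ?eqxx ?scaler0 //.
by rewrite addr0 [LHS]mulr1.
Qed.

Lemma dual_comulE f :
  dual_comul f = \sum_(p : G * G) (f (p.1 * p.2)%g : k) *: (δ p.1 ⊗t δ p.2).
Proof.
rewrite [LHS]dual_extS (partition_big (fun p : G * G => (p.1 * p.2)%g) xpredT) //=.
apply: eq_bigr => g _; rewrite scaler_sumr; apply: eq_bigr => p /eqP <-.
by [].
Qed.

Lemma dual_comulEl g :
  dual_comul (δ g) = \sum_a δ a ⊗t δ (a^-1 * g)%g.
Proof.
rewrite dual_extE (reindex (fun a => (a, (a^-1 * g)%g))) /=; last first.
  exists fst => // -[a b]; rewrite inE /= => /eqP <-; by rewrite mulKg.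
by apply: eq_big => // a; rewrite mulKVg eqxx.
Qed.

Lemma dual_comulEr g :
  dual_comul (δ g) = \sum_a δ (g * a^-1)%g ⊗t δ a.
Proof.
rewrite dual_extE (reindex (fun a => ((g * a^-1)%g, a))) /=; last first.
  exists snd => // -[a b]; rewrite inE /= => /eqP <-; by rewrite mulgK.
by apply: eq_big => // a; rewrite mulgKV eqxx.
Qed.

Lemma dual_comulA f :
  tassoc H H H (tmap dual_comul (tid H) (dual_comul f))
  = tmap (tid H) dual_comul (dual_comul f).
Proof.
have E : tassoc H H H \o tmap dual_comul (tid H) \o dual_comul
    =1 tmap (tid H) dual_comul \o dual_comul; last exact: E.
apply: dual_linear_ext => g /=.
rewrite [in LHS]dual_comulEr [in RHS]dual_comulEl !linear_sum.
under eq_bigr do rewrite tmapE dual_comulEl tens_suml linear_sum.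
under [RHS]eq_bigr do rewrite tmapE dual_comulEr tens_sumr.
rewrite exchange_big; apply: eq_bigr => a _; apply: eq_bigr => b _.
by rewrite tassocE mulgA.
Qed.

Lemma dual_counitl f : tlunit H (tmap dual_counit (tid H) (dual_comul f)) = f.
Proof.
have E : tlunit H \o tmap dual_counit (tid H) \o dual_comul =1 tid H;
  last exact: E.
apply: dual_linear_ext => g /=.
rewrite dual_comulEl !linear_sum (bigD1 1%g) //= big1 => [|a /negPf a1].
  by rewrite addr0 tmapE tlunitE dual_counitE ffunE eqxx scale1r invg1 mul1g.
by rewrite tmapE tlunitE dual_counitE ffunE eq_sym a1 scale0r.
Qed.

Lemma dual_counitr f : trunit H (tmap (tid H) dual_counit (dual_comul f)) = f.
Proof.
have E : trunit H \o tmap (tid H) dual_counit \o dual_comul =1 tid H;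
  last exact: E.
apply: dual_linear_ext => g /=.
rewrite dual_comulEr !linear_sum (bigD1 1%g) //= big1 => [|a /negPf a1].
  by rewrite addr0 tmapE trunitE dual_counitE ffunE eqxx scale1r invg1 mulg1.
by rewrite tmapE trunitE dual_counitE ffunE eq_sym a1 scale0r.
Qed.

Lemma dual_comul1 : dual_comul 𝟙 = 𝟙.
Proof.
rewrite dual_comulE [RHS](_ : _ = (\sum_g δ g) ⊗t (\sum_g δ g)) // tens_suml.
under [RHS]eq_bigr do rewrite tens_sumr.
rewrite [RHS]pair_bigA; apply: eq_bigr => p _.
by rewrite dual_oneE scale1r.
Qed.

Lemma dual_comulM f f' : dual_comul (f ∙ f') = dual_comul f ∙ dual_comul f'.
Proof.
rewrite !dual_comulE [RHS]tens_mul_suml; apply: eq_bigr => p _.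
rewrite tens_mul_sumr (bigD1 p) //= big1 => [|q qp]; rewrite tens_mulZ tens_mulE.
  by rewrite !dual_deltaM !eqxx addr0 ffunE.
rewrite !dual_deltaM; move: qp; rewrite eq_sym -pair_eqE /pair_eq negb_and.
by case/orP => /negPf ->; rewrite ?tens0l ?tens0r scaler0.
Qed.

Lemma dual_antipodel f :
  amu H (tmap dual_antipode (tid H) (dual_comul f)) = (dual_counit f : k) *: 𝟙.
Proof.
have E : amu H \o tmap dual_antipode (tid H) \o dual_comul
   =1 dual_ext (fun g => ((g == 1%g)%:R : k) *: (𝟙 : H)).
  apply: dual_linear_ext => g; rewrite dual_extE /= dual_comulEl.
  case: eqP => [->|/eqP g1].
    rewrite scale1r !linear_sum; under eq_bigr do rewrite tmapE dual_extE amuE mulg1.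
    under eq_bigr do rewrite dual_deltaM eqxx.
    by rewrite (reindex_inj invg_inj); under eq_bigr do rewrite invgK.
  rewrite scale0r !linear_sum big1 // => a _; rewrite tmapE dual_extE amuE dual_deltaM.
  by rewrite -{1}[a^-1%g]mulg1 (inj_eq (mulgI _)) eq_sym (negPf g1).
rewrite [LHS]E [dual_counit f]dual_extS dual_extS scaler_suml; apply: eq_bigr => g _.
by rewrite scalerA.
Qed.

Lemma dual_antipoder f :
  amu H (tmap (tid H) dual_antipode (dual_comul f)) = (dual_counit f : k) *: 𝟙.
Proof.
have E : amu H \o tmap (tid H) dual_antipode \o dual_comul
   =1 dual_ext (fun g => ((g == 1%g)%:R : k) *: (𝟙 : H)).
  apply: dual_linear_ext => g; rewrite dual_extE /= dual_comulEr.
  case: eqP => [->|/eqP g1].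
    rewrite scale1r !linear_sum; under eq_bigr do rewrite tmapE dual_extE amuE mul1g.
    under eq_bigr do rewrite dual_deltaM eqxx.
    by rewrite (reindex_inj invg_inj); under eq_bigr do rewrite invgK.
  rewrite scale0r !linear_sum big1 // => a _; rewrite tmapE dual_extE amuE dual_deltaM.
  by rewrite -{2}[a^-1%g]mul1g (inj_eq (mulIg _)) (negPf g1).
rewrite [LHS]E [dual_counit f]dual_extS dual_extS scaler_suml; apply: eq_bigr => g _.
by rewrite scalerA.
Qed.

Lemma dual_counit1 : dual_counit 𝟙 = (1 : k).
Proof. by rewrite dual_counitE [LHS]dual_oneE. Qed.

Lemma dual_counitM f f' :
  dual_counit (f ∙ f') = (dual_counit f : k) * dual_counit f'.
Proof. by rewrite !dual_counitE ffunE. Qed.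

HB.instance Definition _ := isHopfAlgebra.Build k H
  dual_comulA dual_counitl dual_counitr dual_comul1 dual_comulM
  dual_counit1 dual_counitM dual_antipodel dual_antipoder.

End DualHopf.

Section DualComodule.
Variables (k : comPzRingType) (G : finGroupType).
Local Notation H := (dual_group_alg k G).
Local Notation δ := (@dual_delta k G).

Lemma dual_eval_linear (g : G) : linear (fun f : H => f g : k^o).
Proof. by move=> a x y; rewrite !ffunE. Qed.

Definition dual_eval (g : G) : {linear H -> k^o} :=
  HB.pack (fun f : H => f g : k^o)
    (GRing.isLinear.Build k H k^o *:%R _ (dual_eval_linear g)).

Definition tens_coef (M : lmodType k) (g : G) : {linear M ⊗ H -> M} :=
  trunit M \o tmap (tid M) (dual_eval g).

Lemma tens_coefE (M : lmodType k) g (m : M) (f : H) :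
  tens_coef M g (m ⊗t f) = (f g : k) *: m.
Proof. by rewrite /= tmapE trunitE. Qed.

Lemma tens_coefK (M : lmodType k) (x : M ⊗ H) :
  x = \sum_g tens_coef M g x ⊗t δ g.
Proof.
move: (repr x) (tensor_sum x) => s ->.
under [RHS]eq_bigr do rewrite linear_sum tens_suml.
rewrite exchange_big; apply: eq_bigr => p _.
rewrite {1}(dual_decomp p.2) tens_sumr; apply: eq_bigr => g _.
by rewrite tens_coefE tensZl tensZr.
Qed.

Lemma tens_coef_sum (M : lmodType k) (m : G -> M) h :
  tens_coef M h (\sum_g m g ⊗t δ g) = m h.
Proof.
rewrite linear_sum (bigD1 h) //= big1 => [|g gh]; rewrite tmapE trunitE /=.
  by rewrite ffunE eqxx scale1r addr0.
by rewrite ffunE eq_sym (negPf gh) scale0r.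
Qed.

(* gamma(g)(m) is the coefficient of delta_g in Delta_M(m), that is
   Delta_M(m) = \sum_g gamma(g)(m) (x) delta_g: see coaction_gamma,
   gamma_unique. *)
Definition gamma (M : comoduleType H) (g : G) : {linear M -> M} :=
  tens_coef M g \o coaction.

Lemma coaction_gamma (M : comoduleType H) (m : M) :
  coaction m = \sum_g gamma M g m ⊗t δ g.
Proof. exact: tens_coefK. Qed.

Lemma gamma_unique (M : comoduleType H) (m : M) (n : G -> M) :
  coaction m = \sum_g n g ⊗t δ g -> forall g, gamma M g m = n g.
Proof. by move=> E g; rewrite /= E [LHS]tens_coef_sum. Qed.

Lemma gamma1 (M : comoduleType H) : gamma M 1%g =1 id.
Proof.
move=> m; rewrite -[RHS](@coaction_counit k H M).
have E : tens_coef M 1%g =1 trunit M \o tmap (tid M) counit.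
  apply: tensor_linear_ext => n f /=; rewrite !tmapE !trunitE.
  by rewrite [counit f]dual_counitE.
exact: E.
Qed.

Lemma gammaM (M : comoduleType H) (g h : G) :
  gamma M (g * h)%g =1 gamma M g \o gamma M h.
Proof.
move=> m.
have [F FE] : exists F : {linear M ⊗ (H ⊗ H) -> M}, forall (n : M) (f f' : H),
    F (n ⊗t (f ⊗t f')) = ((f g : k) * f' h) *: n.
  exists (trunit M \o tmap (tid M) (trunit k^o \o
    tmap (dual_eval g) (dual_eval h) : {linear H ⊗ H -> k^o})) => n f f'.
  by rewrite /= tmapE /= tmapE !trunitE mulrC.
have E1 : tens_coef M (g * h)%g =1 F \o tmap (tid M) comul.
  apply: tensor_linear_ext => n f; rewrite tens_coefE.
  rewrite [RHS](_ : _ = F (n ⊗t comul f)); last by rewrite -[n in RHS]/(tid M n) -tmapE.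
  rewrite [comul f]dual_comulE tens_sumr linear_sum (bigD1 (g, h)) //= big1.
    rewrite addr0 -{1}[n]scale1r -[1 in LHS]mulr1 tensZr [RHS]linearZ.
    by congr (_ *: _); rewrite FE !ffunE !eqxx.
  move=> [x y] /=; rewrite -pair_eqE /pair_eq negb_and tensZr linearZ /= FE.
  rewrite !ffunE ![_ == x]eq_sym ![_ == y]eq_sym.
  by case/orP => /negPf ->; rewrite ?mul0r ?mulr0 scale0r scaler0.
have E2 : F \o tassoc M H H =1 tens_coef M g \o tens_coef (M ⊗ H) h.
  apply: tensor_linear_ext => x f; rewrite /comp.
  move: (repr x) (tensor_sum x) => s ->; rewrite tens_suml !linear_sum.
  apply: eq_bigr => p _ /=; rewrite tassocE FE.
  by rewrite tmapE trunitE !linearZ /= tmapE trunitE scalerA mulrC.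
have E3 : tens_coef (M ⊗ H) h \o tmap coaction (tid H)
    =1 coaction \o tens_coef M h.
  apply: tensor_linear_ext => n f /=.
  by rewrite !tmapE !trunitE linearZ.
rewrite /gamma [LHS]E1 [LHS]/= -coactionA.
by rewrite [LHS]E2; congr (tens_coef M g _); exact: E3.
Qed.

Lemma gammaK (M : comoduleType H) (g : G) : cancel (gamma M g) (gamma M g^-1%g).
Proof. by move=> m; rewrite -[LHS]gammaM mulVg gamma1. Qed.

Lemma gammaVK (M : comoduleType H) (g : G) :
  cancel (gamma M g^-1%g) (gamma M g).
Proof. by move=> m; rewrite -[LHS]gammaM mulgV gamma1. Qed.

Lemma gamma_ract (S : comodAlgType H) (M : hopfModType S) (g : G) m (s : S) :
  gamma M g (m ⊲ s) = gamma M g m ⊲ gamma S g s.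
Proof.
apply: (gamma_unique (n := fun g => gamma M g m ⊲ gamma S g s)).
rewrite coaction_ract !coaction_gamma tens_ract_suml.
apply: eq_bigr => h _; rewrite tens_ract_sumr (bigD1 h) //= big1.
  by rewrite tens_ractE dual_deltaM eqxx addr0.
by move=> x xh; rewrite tens_ractE dual_deltaM eq_sym (negPf xh) tens0r.
Qed.

Section Conjugation.
Variables (S : comodAlgType H) (M : hopfModType S).

Lemma conj_autS_subproof (g : G) (f : autS M) :
  is_autS (gamma M g \o autS_fun f \o gamma M g^-1%g).
Proof.
case: f => f [fS fb]; split=> [m s|].
  rewrite [LHS](_ : _ = gamma M g (f (gamma M g^-1%g (m ⊲ s)))) //.
  by rewrite gamma_ract fS gamma_ract gammaVK.
apply: bij_comp; last by exists (gamma M g); [exact: gammaVK|exact: gammaK].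
apply: bij_comp => //.
by exists (gamma M g^-1%g); [exact: gammaK|exact: gammaVK].
Qed.

Definition conj_autS (g : G) (f : autS M) : autS M :=
  exist _ _ (conj_autS_subproof g f).

Lemma conj_autS1 f : conj_autS 1%g f = f.
Proof.
apply: autS_ext => m; rewrite [LHS]gamma1; congr (autS_fun f _).
by rewrite invg1; apply: gamma1.
Qed.

Lemma conj_autSM g h f : conj_autS (g * h)%g f = conj_autS g (conj_autS h f).
Proof.
apply: autS_ext => m; rewrite [LHS]gammaM invMg.
congr (gamma M g (gamma M h (autS_fun f _))).
exact: gammaM.
Qed.

Lemma conj_autS_morph g (f f' : autS M) :
  conj_autS g (f * f')%g = (conj_autS g f * conj_autS g f')%g.
Proof.
apply: autS_ext => m.
rewrite [RHS](_ : _ = gamma M g (autS_fun f (gamma M g^-1%g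
  (gamma M g (autS_fun f' (gamma M g^-1%g m)))))) //.
by rewrite gammaK.
Qed.

Definition conj_action : group_action G (autS M) :=
  GroupActionOnGroup conj_autS1 conj_autSM conj_autS_morph.

End Conjugation.
End DualComodule.

(* Main.v *)
From HB Require Import structures.
Require Import Defs.
From mathcomp Require Import all_boot all_order all_algebra fingroup.
From mathcomp Require Import classical_sets.
From mathcomp Require Import generic_quotient boolp.

(** A k-linear map Phi : M -> M (x) k^G is the same thing as a family
    (Phi_g), indexed by G, of endomorphisms of M, where
    Phi(m) = \sum_g Phi_g(m) (x) delta_g; likewise a map M -> M (x) k^G (x) k^G
    is a family indexed by G x G.  Under this dictionary the Hopf-theoretic
    data become group-theoretic:
    - the product (.) is componentwise composition ([coef_odot]), because
      each coefficient functional, evaluation at a point of G or of G x G, is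
      multiplicative;
    - the components of d^2 Phi, d^1 Phi and d^0 Phi at (a, b) are Phi_a,
      Phi_(ab) and gamma(a) Phi_b gamma(a)^-1
      ([coef_cobord2_1], [coef_cobord1_1], [coef_cobord0_1]).
    So the equation d^2 Phi (.) d^0 Phi = d^1 Phi says exactly that
    Phi_(ab) = Phi_a o ^a(Phi_b), and the counit condition says Phi_1 = id.
    Together these force every Phi_g to be bijective, with inverse
    ^g(Phi_(g^-1)); hence g |-> Phi_g is a 1-cocycle with values in Aut_S(M),
    and every such cocycle arises from a unique Phi.  In the same way the
    g-component of Phi <- f is f^-1 o Phi_g o ^g f ([coef_hopf_twist]), so
    the bijection between cocycles respects the two orbit relations and
    descends to the cohomology sets. *)

Set Implicit Arguments.
Unset Strict Implicit.
Unset Printing Implicit Defensive.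

Import GRing.Theory.
Local Open Scope ring_scope.

(** * Orbit sets *)

Section Orbits.

Lemma orbits_ext (Z : Type) (R : Z -> Z -> Prop) (O O' : orbits R) :
  sval O = sval O' -> O = O'.
Proof.
by case: O O' => [O pO] [O' pO'] /= E; apply: eq_exist.
Qed.

Variables (Z Z' : Type) (R : Z -> Z -> Prop) (R' : Z' -> Z' -> Prop).
Variables (f : Z -> Z') (f' : Z' -> Z).
Hypothesis f'K : cancel f' f.
Hypothesis Rf : forall z z', R z z' <-> R' (f z) (f z').

Lemma preimage_orbit_of z :
  (f' @^-1` orbit_of R z = orbit_of R' (f z))%classic.
Proof.
apply/funext => y; apply/propext.
by rewrite /preimage /orbit_of /mkset /= Rf f'K.
Qed.

Lemma transport_orbit_subproof (O : orbits R) :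
  exists z', (f' @^-1` sval O)%classic = orbit_of R' z'.
Proof.
by case: O => O /= [z ->]; exists (f z); apply: preimage_orbit_of.
Qed.

(** Pulling an orbit, as a subset, back along the inverse f' amounts to taking
    its image under f, with no representative to choose. *)
Definition transport_orbit (O : orbits R) : orbits R' :=
  exist _ _ (transport_orbit_subproof O).

Lemma transport_orbit_class z :
  transport_orbit (orbit_class R z) = orbit_class R' (f z).
Proof. by apply: orbits_ext; apply: preimage_orbit_of. Qed.

End Orbits.

Lemma orbits_bijection (Z Z' : Type) (R : Z -> Z -> Prop)
    (R' : Z' -> Z' -> Prop) (f : Z -> Z') (f' : Z' -> Z)
    (fK : cancel f f') (f'K : cancel f' f)
    (Rf : forall z z', R z z' <-> R' (f z) (f z')) :
  exists F : orbits R -> orbits R',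
    bijective F /\ forall z, F (orbit_class R z) = orbit_class R' (f z).
Proof.
have Rf' z z' : R' z z' <-> R (f' z) (f' z') by rewrite Rf !f'K.
exists (transport_orbit f'K Rf); split; last exact: transport_orbit_class.
exists (transport_orbit fK Rf') => O; apply: orbits_ext; apply/funext => z.
  by rewrite /= /preimage /mkset fK.
by rewrite /= /preimage /mkset f'K.
Qed.

(** * Coefficients of linear maps into M (x) A *)

Section Coefficient.
Variable k : comPzRingType.

(** The map id_M (x) e : M (x) A -> M (x) k = M; for A = k^G and e the
    evaluation at g, it is convertible to [tens_coef M g]. *)
Definition coef (M A : lmodType k) (e : {linear A -> k^o}) :
  {linear M ⊗ A -> M} := trunit M \o tmap (tid M) e.

Lemma coefE (M A : lmodType k) (e : {linear A -> k^o}) m x :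
  coef M e (m ⊗t x) = (e x : k) *: m.
Proof. by rewrite /= tmapE trunitE. Qed.

Lemma coef_tmapl (M N A : lmodType k) (e : {linear A -> k^o})
    (f : {linear M -> N}) x :
  coef N e (tmap f (tid A) x) = f (coef M e x).
Proof.
have E : coef N e \o tmap f (tid A) =1 f \o coef M e; last exact: E.
by apply: tensor_linear_ext => m y; rewrite /= !tmapE !trunitE linearZ.
Qed.

(** Evaluating a product at a character e evaluates both factors, which is why
    the product (.) acts componentwise. *)
Lemma coef_mul (M : lmodType k) (A : assocAlgType k) (e : {linear A -> k^o})
    (eM : forall x y, e (x ∙ y) = (e x : k) * e y) (y : M ⊗ A) (a : A) :
  coef M e (tmap (tid M) (amu A) (tassoc M A A (y ⊗t a)))
  = (e a : k) *: coef M e y.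
Proof.
move: (repr y) (tensor_sum y) => s ->.
rewrite tens_suml !linear_sum; apply: eq_bigr => p _.
by rewrite tassocE tmapE coefE /= amuE eM tmapE trunitE scalerA mulrC.
Qed.

Lemma coef_odot (H : hopfAlgType k) (S : comodAlgType H) (M : hopfModType S)
    (A : assocAlgType k) (e : {linear A -> k^o})
    (eM : forall x y, e (x ∙ y) = (e x : k) * e y)
    (phi psi : {linear M -> M ⊗ A}) m :
  coef M e (odot phi psi m) = coef M e (phi (coef M e (psi m))).
Proof.
have E : coef M e \o tmap (tid M) (amu A) \o tassoc M A A \o tmap phi (tid A)
    =1 coef M e \o phi \o coef M e; last exact: E.
apply: tensor_linear_ext => n a.
rewrite [RHS](_ : _ = coef M e (phi (coef M e (n ⊗t a)))) //.
rewrite coefE [phi _]linearZ [RHS]linearZ -[RHS](coef_mul eM).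
by rewrite /= tmapE.
Qed.

End Coefficient.

(** * Coefficients over the Hopf algebra k^G *)

Section DualCoefficient.
Variables (k : comPzRingType) (G : finGroupType).
Local Notation H := (dual_group_alg k G).
Local Notation δ := (@dual_delta k G).
Implicit Types (g a b : G).

Definition dual_eval2 a b : {linear H ⊗ H -> k^o} :=
  trunit k^o \o tmap (dual_eval k a) (dual_eval k b).

Lemma dual_eval2E a b (f f' : H) :
  dual_eval2 a b (f ⊗t f') = (f a : k) * f' b.
Proof. by rewrite /= tmapE trunitE /= mulrC. Qed.

Lemma dual_evalM g (f f' : H) :
  dual_eval k g (f ∙ f') = (dual_eval k g f : k) * dual_eval k g f'.
Proof. by rewrite /= ffunE. Qed.

Lemma dual_eval2M a b (x y : H ⊗ H) :
  dual_eval2 a b (x ∙ y) = (dual_eval2 a b x : k) * dual_eval2 a b y.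
Proof.
move: (repr x) (tensor_sum x) (repr y) (tensor_sum y) => s -> t ->.
rewrite [_ ∙ _]tens_mul_suml !linear_sum mulr_suml; apply: eq_bigr => p _.
rewrite tens_mul_sumr !linear_sum mulr_sumr; apply: eq_bigr => q _.
by rewrite tens_mulE !dual_eval2E !ffunE mulrACA.
Qed.

Lemma dual_eval2_comul a b (f : H) :
  dual_eval2 a b (comul f) = dual_eval k (a * b)%g f.
Proof.
rewrite [comul f]dual_comulE linear_sum (bigD1 (a, b)) // big1.
  by rewrite [LHS]addr0 linearZ dual_eval2E !ffunE !eqxx mulr1 [LHS]mulr1.
case=> x y /andP[_]; rewrite -pair_eqE /pair_eq negb_and => xy.
rewrite linearZ dual_eval2E !ffunE [a == x]eq_sym [b == y]eq_sym.
by case/orP: xy => /negPf /= ->; rewrite ?(mul0r, mulr0) scaler0.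
Qed.

Lemma dual_eval_antipode a (f : H) :
  dual_eval k a (antipode f) = dual_eval k a^-1%g f.
Proof.
have E : dual_eval k a \o antipode =1 dual_eval k a^-1%g; last exact: E.
apply: dual_linear_ext => g.
rewrite [LHS](_ : _ = dual_eval k a (dual_antipode k G (δ g))) //.
by rewrite dual_extE /= !ffunE eq_invg_sym eq_sym.
Qed.

Variable M : lmodType k.

Lemma tens_coef_inj (x y : M ⊗ H) :
  (forall g, tens_coef M g x = tens_coef M g y) -> x = y.
Proof.
by move=> E; rewrite (tens_coefK x) (tens_coefK y); under eq_bigr do rewrite E.
Qed.

Lemma coef2K (x : M ⊗ (H ⊗ H)) :
  x = \sum_a \sum_b coef M (dual_eval2 a b) x ⊗t (δ a ⊗t δ b).
Proof.
move: (repr x) (tensor_sum x) => s ->.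
under [RHS]eq_bigr => a _ do
  (under eq_bigr do rewrite linear_sum tens_suml; rewrite exchange_big).
rewrite exchange_big; apply: eq_bigr => p _; move: p.1 p.2 => m y.
move: (repr y) (tensor_sum y) => t ->.
under [RHS]eq_bigr => a _ do under eq_bigr => b _ do
  rewrite tens_sumr !linear_sum tens_suml.
under [RHS]eq_bigr => a _ do rewrite exchange_big.
rewrite tens_sumr exchange_big; apply: eq_bigr => q _; move: q.1 q.2 => f f'.
rewrite {1}(dual_decomp f) {1}(dual_decomp f') tens_suml tens_sumr.
apply: eq_bigr => a _; rewrite !tens_sumr; apply: eq_bigr => b _.
by rewrite coefE dual_eval2E !(tensZl, tensZr) scalerA.
Qed.

Lemma coef2_inj (x y : M ⊗ (H ⊗ H)) :
  (forall a b, coef M (dual_eval2 a b) x = coef M (dual_eval2 a b) y) -> x = y.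
Proof.
move=> E; rewrite (coef2K x) (coef2K y).
by apply: eq_bigr => a _; apply: eq_bigr => b _; rewrite E.
Qed.

End DualCoefficient.

(** * Cochains with values in a Hopf module *)

Section Cochain.
Variables (k : comPzRingType) (G : finGroupType).
Local Notation H := (dual_group_alg k G).
Local Notation δ := (@dual_delta k G).
Variables (S : comodAlgType H) (M : hopfModType S).
Implicit Types (g a b : G) (Phi : {linear M -> M ⊗ H}) (m : M).

Lemma coef_cobord2_1 a b Phi m :
  coef M (dual_eval2 k a b) (cobord2_1 Phi m) = tens_coef M a (Phi m).
Proof.
have E : coef M (dual_eval2 k a b) \o tassoc M H H \o tens_r (M ⊗ H) 𝟙
    =1 tens_coef M a; last exact: E.
apply: tensor_linear_ext => n f.
rewrite [LHS](_ : _ = coef M (dual_eval2 k a b) (tassoc M H H (n ⊗t f ⊗t 𝟙))) //.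
by rewrite tassocE coefE dual_eval2E dual_oneE mulr1 tens_coefE.
Qed.

Lemma coef_cobord1_1 a b Phi m :
  coef M (dual_eval2 k a b) (cobord1_1 Phi m) = tens_coef M (a * b)%g (Phi m).
Proof.
have E : coef M (dual_eval2 k a b) \o tmap (tid M) comul
    =1 tens_coef M (a * b)%g; last exact: E.
apply: tensor_linear_ext => n f; rewrite tens_coefE.
rewrite [LHS](_ : _ = coef M (dual_eval2 k a b) (tmap (tid M) comul (n ⊗t f))) //.
by rewrite tmapE coefE dual_eval2_comul.
Qed.

(** In d^0 the comodule map is applied before and after Phi.  The first
    application yields gamma(g)(m) (x) delta_g, and the antipode turns
    delta_g into delta_(g^-1), which is then multiplied with the delta_x
    coming from the second application.  At delta_a only x = a and g = a^-1
    survive, whence the conjugation by gamma(a). *)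
Lemma coef_cobord0_1 a b Phi m :
  coef M (dual_eval2 k a b) (cobord0_1 Phi m)
  = gamma M a (tens_coef M b (Phi (gamma M a^-1%g m))).
Proof.
pose C : {linear M ⊗ H ⊗ H -> M ⊗ (H ⊗ H)} := tmap (tid M) (tmap (amu H) (tid H))
  \o tmap (tid M) (tassocV H H H) \o tassoc M H (H ⊗ H)
  \o tmap coaction (tflip H H) \o tassoc M H H.
have CE (x : M ⊗ H) (f : H) : coef M (dual_eval2 k a b) (C (x ⊗t f))
    = (f a : k) *: gamma M a (tens_coef M b x).
  move: (repr x) (tensor_sum x) => s ->.
  rewrite tens_suml !linear_sum; apply: eq_bigr => p _.
  move: p.1 p.2 => n f'.
  rewrite /C /= !tassocE !tmapE tflipE trunitE !linearZ /=.
  move: (coaction n : M ⊗ H) => y.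
  move: (repr y) (tensor_sum y) => t ->.
  rewrite tens_suml !linear_sum; apply: eq_bigr => q _.
  rewrite tassocE !tmapE tassocVE tmapE amuE /=.
  rewrite tmapE /= !trunitE !ffunE !scalerA; congr (_ *: _).
  exact: mulrAC.
have E : coef M (dual_eval2 k a b) \o C \o tmap Phi antipode
    =1 gamma M a \o tens_coef M b \o Phi \o tens_coef M a^-1%g; last exact: E.
apply: tensor_linear_ext => n f.
rewrite [LHS](_ : _ = coef M (dual_eval2 k a b) (C (tmap Phi antipode (n ⊗t f)))) //.
rewrite tmapE CE [X in X *: _](dual_eval_antipode a f).
rewrite [RHS](_ : _ = gamma M a (tens_coef M b (Phi (tens_coef M a^-1%g (n ⊗t f))))) //.
by rewrite tens_coefE !linearZ.
Qed.

Lemma coef_cobord1_0 g (f : {linear M -> M}) m :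
  tens_coef M g (cobord1_0 f m) = f m.
Proof.
rewrite [cobord1_0 f m](_ : _ = f m ⊗t 𝟙) //.
by rewrite tens_coefE dual_oneE scale1r.
Qed.

Lemma coef_cobord0_0 g (f : {linear M -> M}) m :
  tens_coef M g (cobord0_0 f m) = gamma M g (f (gamma M g^-1%g m)).
Proof.
have E : tens_coef M g \o tmap (tid M) (amu H) \o tassoc M H H
    \o tmap coaction (tid H) \o tmap f antipode
    =1 gamma M g \o f \o tens_coef M g^-1%g; last exact: E.
apply: tensor_linear_ext => n x.
rewrite [LHS](_ : _ = tens_coef M g (tmap (tid M) (amu H) (tassoc M H H
  (tmap coaction (tid H) (tmap f antipode (n ⊗t x)))))) //.
rewrite !tmapE [LHS](coef_mul (dual_evalM g)).
rewrite dual_eval_antipode.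
rewrite [RHS](_ : _ = gamma M g (f (tens_coef M g^-1%g (n ⊗t x)))) //.
by rewrite tens_coefE !linearZ.
Qed.

Lemma coef_hopf_twist Phi (f : autS M) g m :
  tens_coef M g (hopf_twist Phi f m)
  = autS_fun f^-1%g
      (tens_coef M g (Phi (gamma M g (autS_fun f (gamma M g^-1%g m))))).
Proof.
rewrite [LHS](coef_odot (dual_evalM g)) [LHS](coef_odot (dual_evalM g)).
by rewrite [LHS]coef_cobord1_0 -coef_cobord0_0.
Qed.

(** The delta_g and the delta_a (x) delta_b being bases, each of the three
    equations defining a Hopf cocycle can be tested coefficient by
    coefficient; the counit is the coefficient at 1. *)
Lemma hopf_cocycleP Phi : is_hopf_cocycle Phi <->
  [/\ forall g m (s : S),
        tens_coef M g (Phi (m ⊲ s)) = tens_coef M g (Phi m) ⊲ s,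
      forall m, tens_coef M 1%g (Phi m) = m
    & forall a b m, tens_coef M (a * b)%g (Phi m)
        = tens_coef M a (Phi (gamma M a
            (tens_coef M b (Phi (gamma M a^-1%g m)))))].
Proof.
have counitE (x : M ⊗ H) : trunit M (tmap (tid M) counit x) = tens_coef M 1%g x.
  move: x; apply: (@tensor_linear_ext _ _ _ _ (coef M counit)) => n f.
  by rewrite coefE tens_coefE [counit f]dual_counitE.
split=> [[PhiS Phi1 PhiM]|[PhiS Phi1 PhiM]]; split.
- by move=> g m s; rewrite PhiS [LHS]coef_tmapl.
- by move=> m; rewrite -counitE.
- move=> a b m; rewrite -coef_cobord1_1 -PhiM.
  by rewrite (coef_odot (dual_eval2M a b)) coef_cobord2_1 coef_cobord0_1.
- by move=> m s; apply: tens_coef_inj => g; rewrite PhiS [RHS]coef_tmapl.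
- by move=> m; rewrite counitE.
- apply: linear_ext => m; apply: coef2_inj => a b.
  rewrite (coef_odot (dual_eval2M a b)) coef_cobord2_1 coef_cobord0_1.
  by rewrite coef_cobord1_1 PhiM.
Qed.

(** * The bijection between cocycles *)

(** The relations at (g, g^-1) and (g^-1, g), the latter conjugated by
    gamma(g), exhibit ^g(Phi_(g^-1)) as a two-sided inverse of Phi_g. *)
Lemma hopf_cocycle_is_autS Phi (cPhi : is_hopf_cocycle Phi) g :
  is_autS (tens_coef M g \o Phi).
Proof.
have [PhiS Phi1 PhiM] := iffLR (hopf_cocycleP Phi) cPhi.
split=> [m s|]; first exact: PhiS.
exists (gamma M g \o tens_coef M g^-1%g \o Phi \o gamma M g^-1%g) => m.
  have := PhiM g^-1%g g (gamma M g^-1%g m).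
  rewrite mulVg Phi1 invgK gammaVK => /(congr1 (gamma M g)).
  by rewrite gammaVK => {2}->.
by have := PhiM g g^-1%g m; rewrite mulgV Phi1 => {2}->.
Qed.

Definition hopf_component (Phi : hopfZ1 M) g : autS M :=
  exist _ _ (hopf_cocycle_is_autS (svalP Phi) g).

Lemma hopf_component_cocycle (Phi : hopfZ1 M) a b :
  hopf_component Phi (a * b)%g
  = (hopf_component Phi a * conj_action M a (hopf_component Phi b))%g.
Proof.
have [_ _ PhiM] := iffLR (hopf_cocycleP _) (svalP Phi).
by apply: autS_ext => m; apply: PhiM.
Qed.

Definition group_of_hopf (Phi : hopfZ1 M) : groupZ1 (conj_action M) :=
  exist _ _ (hopf_component_cocycle Phi).

Lemma hopf_of_family_linear (w : G -> {linear M -> M}) :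
  linear (fun m => \sum_g w g m ⊗t δ g).
Proof.
move=> c x y; rewrite scaler_sumr -big_split; apply: eq_bigr => g _ /=.
by rewrite linearP tensDl tensZl.
Qed.

Definition hopf_of_family (w : G -> {linear M -> M}) : {linear M -> M ⊗ H} :=
  HB.pack (fun m => \sum_g w g m ⊗t δ g)
    (GRing.isLinear.Build k M (M ⊗ H) *:%R _ (hopf_of_family_linear w)).

Lemma coef_hopf_of_family (w : G -> {linear M -> M}) g m :
  tens_coef M g (hopf_of_family w m) = w g m.
Proof. exact: (tens_coef_sum (fun g => w g m)). Qed.

Lemma hopf_of_family_cocycle (alpha : groupZ1 (conj_action M)) :
  is_hopf_cocycle (hopf_of_family (fun g => autS_fun (sval alpha g))).
Proof.
case: alpha => alpha alphaM; apply/hopf_cocycleP; split.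
- move=> g m s; rewrite !coef_hopf_of_family /=.
  by case: (alpha g) => f [fS ?]; apply: fS.
- have alpha1 : alpha 1%g = 1%g.
    apply: (mulgI (alpha 1%g)); rewrite mulg1.
    by rewrite -{2}[alpha 1%g](gact_fun1 (conj_action M)) -alphaM mulg1.
  by move=> m; rewrite coef_hopf_of_family /= alpha1.
- by move=> a b m; rewrite !coef_hopf_of_family /= alphaM.
Qed.

Definition hopf_of_group (alpha : groupZ1 (conj_action M)) : hopfZ1 M :=
  exist _ _ (hopf_of_family_cocycle alpha).

Lemma hopfZ1_ext (Phi Psi : hopfZ1 M) :
  (forall g m, tens_coef M g (sval Phi m) = tens_coef M g (sval Psi m)) ->
  Phi = Psi.
Proof.
case: Phi Psi => [Phi cPhi] [Psi cPsi] /= E.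
by apply/eq_exist/linear_ext => m; apply: tens_coef_inj => g; apply: E.
Qed.

Lemma groupZ1_ext (alpha beta : groupZ1 (conj_action M)) :
  (forall g, sval alpha g = sval beta g) -> alpha = beta.
Proof.
by case: alpha beta => [alpha ca] [beta cb] /= /funext E; apply: eq_exist.
Qed.

Lemma group_of_hopfK : cancel group_of_hopf hopf_of_group.
Proof. by move=> Phi; apply: hopfZ1_ext => g m; rewrite coef_hopf_of_family. Qed.

Lemma hopf_of_groupK : cancel hopf_of_group group_of_hopf.
Proof.
move=> alpha; apply: groupZ1_ext => g; apply: autS_ext => m.
exact: coef_hopf_of_family.
Qed.

Lemma group_of_hopf_cohomologous (Phi Psi : hopfZ1 M) :
  hopf_cohomologous Phi Psi
  <-> group_cohomologous (group_of_hopf Phi) (group_of_hopf Psi).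
Proof.
split=> -[f E]; exists f.
  move=> g; apply: autS_ext => m.
  by rewrite [LHS](_ : _ = tens_coef M g (sval Psi m)) // E coef_hopf_twist.
apply: linear_ext => m; apply: tens_coef_inj => g; rewrite coef_hopf_twist.
exact: (congr1 (fun h => autS_fun h m) (E g)).
Qed.

Lemma group_of_hopf1 :
  group_of_hopf (hopfZ1_one M) = groupZ1_one (conj_action M).
Proof.
apply: groupZ1_ext => g; apply: autS_ext => m.
by rewrite [LHS]tens_coefE dual_oneE scale1r.
Qed.

End Cochain.

Theorem theoremA (k : comPzRingType) (G : finGroupType)
    (S : comodAlgType (dual_group_alg k G)) (M : hopfModType S) :
  exists F : hopfH1 (dual_group_alg k G) M -> groupH1 (conj_action M),
    bijective F /\ F point = point.
Proof.
have [F [F_bij FE]] := orbits_bijection (@group_of_hopfK k G S M)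
  (@hopf_of_groupK k G S M) (@group_of_hopf_cohomologous k G S M).
by exists F; split=> //; rewrite [LHS]FE group_of_hopf1.
Qed.
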